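(* Let $A\rtimes C$ be a semidirect product of groups which is a $2$-almost direct product of $A$ and $C$. Then, under the identification of $\mathbb{F}_2[A]\otimes\mathbb{F}_2[C]$ with $\mathbb{F}_2[A\rtimes C]$ given by $a\otimes c\mapsto ac$, one has for all $k$ $$\overline{\mathbb{F}_2[A\rtimes C]}^{\,k}=\sum_{i+h=k}\overline{\mathbb{F}_2[A]}^{\,i}\otimes\overline{\mathbb{F}_2[C]}^{\,h}.$$
   Context: For a group $G$, $\mathbb{F}_2[G]$ is the group ring over the field $\mathbb{F}_2$, and $\overline{\mathbb{F}_2[G]}$ is its augmentation ideal; $\overline{\mathbb{F}_2[G]}^{\,j}$ is its $j$-th power (with $0$-th power equal to $\mathbb{F}_2[G]$). The map $a\otimes c\mapsto ac$ induces an $\mathbb{F}_2$-linear isomorphism $\mathbb{F}_2[A]\otimes_{\mathbb{F}_2}\mathbb{F}_2[C]\to\mathbb{F}_2[A\rtimes C]$. The indices $i,h$ in the sum are nonnegative integers. A semidirect product $A\rtimes C$ is a $2$-almost direct product of $A$ and $C$ if the action of $C$ induced on $H_1(A;\mathbb{F}_2)=A/\gamma_2^2A$ is trivial, where $\gamma_2^2A$ is the subgroup of $A$ generated by $[A,A]$ and all squares of elements of $A$. *)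

(* Defs.v *)
From HB Require Import structures.
From mathcomp Require Import all_boot all_order all_algebra finmap.
From mathcomp Require Import monalg.
From mathcomp Require Import boolp classical_sets.

Set Implicit Arguments.
Unset Strict Implicit.
Unset Printing Implicit Defensive.

Import GRing.Theory.

Local Open Scope classical_set_scope.
Local Open Scope ring_scope.
Local Open Scope quotient_scope.

Lemma gmul1 (G H : groupType) (f : {multiplicative G -> H}) : f 1%g = 1%g.
Proof. by apply: (@mulgI _ (f 1%g)); rewrite -gmulfM !mulg1. Qed.

Lemma gmulV (G H : groupType) (f : {multiplicative G -> H}) x :
  f (x^-1)%g = ((f x)^-1)%g.
Proof. by apply: (@mulgI _ (f x)); rewrite -gmulfM !mulgV gmul1. Qed.

Section LinearExtension.
Variables (R : comNzRingType) (K : choiceType) (V : lmodType R).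
Implicit Types (f : K -> V) (g : {malg R[K]}).

(* Linear extension of [f] to the free module [{malg R[K]}] on [K]. *)
Definition linext f g : V := \sum_(k <- msupp g) g@_k *: f k.

Lemma linextEw f (d : {fset K}) g : (msupp g `<=` d)%fset ->
  linext f g = \sum_(k <- d) g@_k *: f k.
Proof.
move=> le_gd; rewrite /linext (big_fset_incl _ le_gd) // => k _.
by move/mcoeff_outdom => ->; rewrite scale0r.
Qed.

Lemma linext_is_linear f : linear (linext f).
Proof.
move=> a u v; pose d := (msupp u `|` msupp v `|` msupp (a *: u + v))%fset.
have [du dv dw] : [/\ msupp u `<=` d, msupp v `<=` d
  & msupp (a *: u + v) `<=` d]%fset.
  by split; apply/fsubsetP => x; rewrite !in_fsetE => ->; rewrite ?orbT.
rewrite (linextEw _ du) (linextEw _ dv) (linextEw _ dw).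
rewrite scaler_sumr -big_split /=; apply: eq_bigr => k _.
by rewrite mcoeffD mcoeffZ scalerDl scalerA.
Qed.

HB.instance Definition _ f :=
  GRing.isLinear.Build R {malg R[K]} V *:%R (linext f) (linext_is_linear f).

Lemma linextU f k : linext f << k >> = f k.
Proof.
by rewrite (@linextEw f [fset k]%fset) ?msuppU_le // big_seq_fset1 mcoeffUU
  scale1r.
Qed.

Lemma eq_linear_malg (W : lmodType R) (f g : {malg R[K]} -> W) :
  linear f -> linear g -> (forall k, f << k >> = g << k >>) -> f =1 g.
Proof.
move=> lin_f lin_g eq_fg u; rewrite (monalgE u).
pose F := GRing.isLinear.Build R {malg R[K]} W *:%R f lin_f.
pose G := GRing.isLinear.Build R {malg R[K]} W *:%R g lin_g.
pose f' : {linear _ -> _} := HB.pack f F.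
pose g' : {linear _ -> _} := HB.pack g G.
rewrite -[f]/(f' : _ -> _) -[g]/(g' : _ -> _) !linear_sum.
apply: eq_bigr => k _.
have -> : << u@_k *g k >> = u@_k *: (<< k >> : {malg R[K]}).
  by apply/malgP => x; rewrite mcoeffZ !mcoeffU mulrnAr mulr1.
by rewrite !linearZ /= eq_fg.
Qed.

Lemma linext_linear a f1 f2 g :
  linext (fun k => a *: f1 k + f2 k) g = a *: linext f1 g + linext f2 g.
Proof.
rewrite /linext scaler_sumr -big_split /=; apply: eq_bigr => k _.
by rewrite scalerDr !scalerA mulrC.
Qed.

End LinearExtension.

Section Span.
Variables (R : nzRingType) (V : lmodType R).

Inductive linspan (S : set V) : V -> Prop :=
| linspan_in x of S x : linspan S x
| linspan0 : linspan S 0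
| linspanD x y of linspan S x & linspan S y : linspan S (x + y)
| linspanZ a x of linspan S x : linspan S (a *: x).

End Span.

Section GroupRing.
Variables (R : comNzRingType) (G : groupType).

Definition grpring := {malg R[G]}.

HB.instance Definition _ := GRing.Lmodule.on grpring.

Definition grmul (u v : grpring) : grpring :=
  linext (fun x => linext (fun y => << (x * y)%g >> : grpring) v) u.

Lemma grmulU x y : grmul << x >> << y >> = << (x * y)%g >>.
Proof. by rewrite /grmul !linextU. Qed.

Lemma grmul_linl v : linear (grmul ^~ v).
Proof. exact: linearP. Qed.

Lemma grmul_linr u : linear (grmul u).
Proof.
move=> a v w; rewrite /grmul -linext_linear; congr (linext _ u).
by apply/funext => x; rewrite linearP.
Qed.

Definition grone : grpring := << 1%g >>.

Lemma grmulA : associative grmul.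
Proof.
move=> u v w; move: u; apply: eq_linear_malg => [||x].
- exact: grmul_linl.
- by move=> a u u'; rewrite !grmul_linl.
move: v; apply: eq_linear_malg => [||y].
- by move=> a v v'; rewrite grmul_linl grmul_linr.
- by move=> a v v'; rewrite grmul_linr grmul_linl.
move: w; apply: eq_linear_malg => [||z].
- by move=> a w w'; rewrite !grmul_linr.
- exact: grmul_linr.
by rewrite !grmulU mulgA.
Qed.

Lemma grmul1 : left_id grone grmul.
Proof.
apply: eq_linear_malg => [||x]; [exact: grmul_linr| by [] |].
by rewrite grmulU mul1g.
Qed.

Lemma grmulr1 : right_id grone grmul.
Proof.
apply: eq_linear_malg => [||x]; [exact: grmul_linl| by [] |].
by rewrite grmulU mulg1.
Qed.

Lemma grmulDl : left_distributive grmul +%R.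
Proof. by move=> u v w; have := grmul_linl w 1 u v; rewrite !scale1r. Qed.

Lemma grmulDr : right_distributive grmul +%R.
Proof. by move=> w u v; have := grmul_linr w 1 u v; rewrite !scale1r. Qed.

Lemma grone_neq0 : grone != 0.
Proof. by rewrite monalgU_eq0 oner_eq0. Qed.

HB.instance Definition _ := GRing.Zmodule_isNzRing.Build grpring
  grmulA grmul1 grmulr1 grmulDl grmulDr grone_neq0.

Lemma grscaleAl (a : R) (u v : grpring) : a *: (u * v) = (a *: u) * v.
Proof.
have eqM x y : x * y = grmul x y by [].
have gr0 : grmul 0 v = 0 by rewrite -eqM mul0r.
by rewrite !eqM; have := grmul_linl v a u 0; rewrite /= gr0 !addr0.
Qed.

HB.instance Definition _ :=
  GRing.Lmodule_isLalgebra.Build R grpring grscaleAl.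

Definition augmentation : grpring -> R^o := linext (fun=> 1 : R^o).

Definition augideal : set grpring := [set u | augmentation u = 0].

End GroupRing.

Arguments augideal R G : clear implicits.

(* An augmentation ideal is an [R]-submodule, so its [R]-linear products below
   are the usual ideal products. *)
Section IdealPowers.
Variables (R : nzRingType) (L : lalgType R).
Implicit Types I J : set L.

Definition idealM I J : set L := linspan [set u * v | u in I & v in J].

Fixpoint idealX I (n : nat) : set L :=
  if n is m.+1 then idealM (idealX I m) I else [set: L].

End IdealPowers.

Section Tensor.
Variables (R : comNzRingType) (G H : groupType).

(* As [R[G]] and [R[H]] are free on [G] and [H], their tensor product over [R]
   is free on [G * H]; [tens_universal] is its universal property. *)
Definition grtensor := {malg R[(G * H)%type]}.

HB.instance Definition _ := GRing.Lmodule.on grtensor.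

Definition tens (u : grpring R G) (v : grpring R H) : grtensor :=
  linext (fun x => linext (fun y => << (x, y) >> : grtensor) v) u.

Lemma tensU x y : tens << x >> << y >> = << (x, y) >>.
Proof. by rewrite /tens !linextU. Qed.

Lemma tens_linl v : linear (tens ^~ v).
Proof. exact: linearP. Qed.

Lemma tens_linr u : linear (tens u).
Proof.
move=> a v w; rewrite /tens -linext_linear; congr (linext _ u).
by apply/funext => x; rewrite linearP.
Qed.

Lemma tens_universal (V : lmodType R) (f : grpring R G -> grpring R H -> V) :
  (forall v, linear (f ^~ v)) -> (forall u, linear (f u)) ->
  exists! g : grtensor -> V, linear g /\ forall u v, g (tens u v) = f u v.
Proof.
move=> lin_fl lin_fr.
exists (linext (fun p => f << p.1 >> << p.2 >>)); split; last first.
  move=> g [lin_g def_g]; apply/funext/eq_linear_malg => // [|[x y]].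
    exact: linearP.
  by rewrite linextU /= -def_g tensU.
split=> [|u v]; first exact: linearP.
move: u; apply: eq_linear_malg => // [a u u'|x].
  by rewrite tens_linl linearP.
move: v; apply: eq_linear_malg => // [a v v'|y].
  by rewrite tens_linr linearP.
by rewrite tensU linextU.
Qed.

(* The image of [I (x) J] in [R[G] (x) R[H]]; when [R] is a field, [I (x) J]
   embeds. *)
Definition tensS (I : set (grpring R G)) (J : set (grpring R H)) :
  set grtensor := linspan [set tens u v | u in I & v in J].

End Tensor.

Record autAction (A C : groupType) := AutAction {
  aut_act :> C -> {multiplicative A -> A};
  aut_act1 : forall a, aut_act 1%g a = a;
  aut_actM : forall c d a, aut_act (c * d)%g a = aut_act c (aut_act d a)
}.

(* [act] is a phantom argument of the carrier: it selects the group law. *)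
Definition semidirect (A C : groupType) (act : autAction A C) : Type :=
  (A * C)%type.

Section Semidirect.
Variables (A C : groupType) (act : autAction A C).

Local Notation semidirect := (semidirect act).

HB.instance Definition _ := Choice.on semidirect.

Implicit Types x y z : semidirect.

Definition sd_one : semidirect := (1%g, 1%g).
Definition sd_mul x y : semidirect :=
  ((x.1 * act x.2 y.1)%g, (x.2 * y.2)%g).
Definition sd_inv x : semidirect := (act (x.2^-1)%g (x.1^-1)%g, (x.2^-1)%g).

Lemma sd_mulA : associative sd_mul.
Proof.
by move=> [a c] [b d] [e f]; rewrite /sd_mul /= gmulfM aut_actM !mulgA.
Qed.

Lemma sd_mul1 : left_id sd_one sd_mul.
Proof. by move=> [a c]; rewrite /sd_mul /= aut_act1 !mul1g. Qed.

Lemma sd_mulr1 : right_id sd_one sd_mul.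
Proof. by move=> [a c]; rewrite /sd_mul /= gmul1 !mulg1. Qed.

Lemma sd_mulV : left_inverse sd_one sd_inv sd_mul.
Proof.
move=> [a c]; rewrite /sd_mul /sd_inv /sd_one /= -gmulfM !mulVg.
by rewrite gmul1.
Qed.

Lemma sd_mulrV : right_inverse sd_one sd_inv sd_mul.
Proof.
move=> [a c]; rewrite /sd_mul /sd_inv /sd_one /= -aut_actM mulgV.
by rewrite aut_act1 mulgV.
Qed.

HB.instance Definition _ := isGroup.Build semidirect
  sd_mulA sd_mul1 sd_mulr1 sd_mulV sd_mulrV.

Definition sd_inl (a : A) : semidirect := (a, 1%g).
Definition sd_inr (c : C) : semidirect := (1%g, c).

(* The linear map [a (x) c |-> a c]; see [sd_tensE] and [sd_tens_bij]. *)
Definition sd_tens (R : comNzRingType) :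
    grtensor R A C -> grpring R semidirect :=
  linext (fun p => << (sd_inl p.1 * sd_inr p.2)%g >> : grpring R semidirect).

Lemma sd_inM a c : (sd_inl a * sd_inr c)%g = (a, c) :> semidirect.
Proof. by congr pair; rewrite /= ?aut_act1 ?mulg1 ?mul1g. Qed.

Lemma sd_inJ a c :
  (sd_inr c * sd_inl a * (sd_inr c)^-1)%g = sd_inl (act c a).
Proof.
rewrite -[LHS]/(sd_mul (sd_mul _ _) (sd_inv _)) /sd_mul /sd_inv /=.
by rewrite invg1 !gmul1 mul1g !mulg1 mulgV.
Qed.

Lemma sd_tensE (R : comNzRingType) (u : grpring R A) (v : grpring R C) :
  sd_tens (tens u v) =
  linext (fun a => << sd_inl a >> : grpring R semidirect) u *
  linext (fun c => << sd_inr c >> : grpring R semidirect) v.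
Proof.
have eqM (x y : grpring R semidirect) : x * y = grmul x y by [].
rewrite eqM; move: u; apply: eq_linear_malg => [b u u'|b u u'|a].
- by rewrite /sd_tens tens_linl linearP.
- by rewrite linearP grmul_linl.
move: v; apply: eq_linear_malg => [b v v'|b v v'|c].
- by rewrite /sd_tens tens_linr linearP.
- by rewrite linearP grmul_linr.
by rewrite /sd_tens tensU !linextU grmulU.
Qed.

Lemma sd_tens_bij (R : comNzRingType) : bijective (@sd_tens R).
Proof.
exists (linext (fun x => << (x.1, x.2) >> : grtensor R A C)).
  apply: eq_linear_malg => [b u v|b u v|[a c]] //.
    by rewrite /sd_tens !linearP.
  by rewrite /sd_tens !linextU sd_inM.
apply: eq_linear_malg => [b u v|b u v|[a c]] //.
  by rewrite /sd_tens !linearP.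
by rewrite /sd_tens !linextU /= sd_inM.
Qed.

End Semidirect.

Arguments sd_tens {A C} act {R} _.

Section ModTwoHomology.
Variable G : groupType.

Inductive generated (S : set G) : G -> Prop :=
| gen_in x of S x : generated S x
| gen1 : generated S 1%g
| genM x y of generated S x & generated S y : generated S (x * y)%g
| genV x of generated S x : generated S (x^-1)%g.

Definition derived : set G :=
  generated [set [~ x, y]%g | x in [set: G] & y in [set: G]].

Definition gamma22 : set G :=
  generated (derived `|` [set (x ^+ 2)%g | x in [set: G]]).

Definition gamma22_eqv (x y : G) : bool := `[< gamma22 (x^-1 * y)%g >].

Lemma gamma22_eqv_refl : reflexive gamma22_eqv.
Proof. by move=> x; apply/asboolP; rewrite mulVg; exact: gen1. Qed.

Lemma gamma22_eqv_sym : symmetric gamma22_eqv.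
Proof.
suff imp x y : gamma22_eqv x y -> gamma22_eqv y x.
  by move=> x y; apply/idP/idP; exact: imp.
by move/asboolP => /genV; rewrite invgM invgK => ?; apply/asboolP.
Qed.

Lemma gamma22_eqv_trans : transitive gamma22_eqv.
Proof.
move=> y x z /asboolP xy /asboolP yz; apply/asboolP.
by have := genM xy yz; rewrite mulgA mulgK.
Qed.

Canonical gamma22_equiv :=
  EquivRel gamma22_eqv gamma22_eqv_refl gamma22_eqv_sym gamma22_eqv_trans.

(* [H_1(G; F_2) = G / gamma_2^2 G]. *)
Definition H1F2 := {eq_quot gamma22_equiv}.

HB.instance Definition _ := EqQuotient.on H1F2.

End ModTwoHomology.

Section AlmostDirect.
Variables (A C : groupType) (act : autAction A C).

Lemma gamma22_morph (G H : groupType) (f : {multiplicative G -> H}) x :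
  gamma22 x -> gamma22 (f x).
Proof.
elim=> [y [dy|[z _ <-]]| |y z _ IHy _ IHz|y _ IHy].
- apply: gen_in; left; elim: dy => [_ [a _ [b _ <-]]| |a b _ IHa _ IHb|a _ IHa].
  + by apply: gen_in; exists (f a) => //; exists (f b);
      rewrite // /commg /conjg !(gmulfM, gmulV).
  + by rewrite gmul1; exact: gen1.
  + by rewrite gmulfM; exact: genM.
  + by rewrite gmulV; exact: genV.
- apply: gen_in; right; exists (f z) => //.
  by rewrite !expgS !expg0 !(gmulfM, gmul1).
- by rewrite gmul1; exact: gen1.
- by rewrite gmulfM; exact: genM.
- by rewrite gmulV; exact: genV.
Qed.

Definition H1F2_act (c : C) (x : H1F2 A) : H1F2 A :=
  \pi_(H1F2 A) (act c (repr x)).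

Lemma H1F2_actE c a : H1F2_act c (\pi_(H1F2 A) a) = \pi_(H1F2 A) (act c a).
Proof.
have /eqmodP/asboolP ra : repr (\pi_(H1F2 A) a) = a %[mod H1F2 A].
  by rewrite reprK.
apply/eqmodP/asboolP.
by rewrite -gmulV -gmulfM; exact: gamma22_morph.
Qed.

(* By [H1F2_actE], [H1F2_act] does not depend on the chosen representatives. *)
Definition two_almost_direct : Prop := forall c x, H1F2_act c x = x.

End AlmostDirect.

(* Main.v *)
Require Import Defs.
From HB Require Import structures.
From mathcomp Require Import all_boot all_order all_algebra finmap.
From mathcomp Require Import monalg.
From mathcomp Require Import boolp classical_sets.

Set Implicit Arguments.
Unset Strict Implicit.
Unset Printing Implicit Defensive.

Import GRing.Theory.

Local Open Scope classical_set_scope.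
Local Open Scope ring_scope.

(** Write [D], [I] and [J] for the augmentation ideals of the group algebras of
    [A ><| C], [A] and [C] over a commutative ring [R], and [T n] for the sum of
    the [I^i J^h] with [i + h = n], taken inside the group algebra of
    [A ><| C].  The identification of the tensor product with that algebra
    sends [u (x) v] to [u v], so the claim is that [D^n = T n].

    That [T n] lies in [D^n] is functoriality: the inclusions of [A] and [C]
    send augmentation ideals into [D].

    The converse amounts to [D T_n <= T_(n+1)], since then
    [D^m T_n <= T_(m+n)] by induction on [m], and [1] lies in [T 0].  As [D] is
    spanned by the elements [a c - 1], the only difficulty is to move [c] past
    an element [u] of [I^i].  With [c.u] for the action of [c] on [u], one has
    [c u = (c.u) c], hence
        [a c u v - u v = a (c.u) (c - 1) v + a (c.u - u) v + (a - 1) u v],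
    and each term gains one degree as soon as [c.u - u] lies in [I^(i+1)].  In
    other words [C] has to act trivially on each quotient [I^i / I^(i+1)].

    These quotients are generated by products of [i] elements of [I / I^2], so
    triviality on [I / I^2] suffices ([grmap_sub_id]).  There it says that
    [c.a - a = a (a^-1 (c.a) - 1)] lies in [I^2].  When [R] has
    characteristic 2, the elements [g] with [g - 1] in [I^2] form a subgroup
    containing all commutators and all squares, that is, containing gamma22
    ([gamma22_sub1]); and the action is trivial on [A / gamma22] precisely when
    every [a^-1 (c.a)] belongs to gamma22. *)

(** * Linear spans *)

Section LinearSpan.
Variables (R : nzRingType) (V W : lmodType R).
Implicit Types (S : set V).

Lemma linspanN S x : linspan S x -> linspan S (- x).
Proof. by move=> Sx; rewrite -scaleN1r; exact: linspanZ. Qed.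

Lemma linspanB S x y : linspan S x -> linspan S y -> linspan S (x - y).
Proof. by move=> Sx Sy; apply: linspanD => //; exact: linspanN. Qed.

Lemma linspan_morph (f : {linear V -> W}) S (S' : set W) :
  (forall x, S x -> linspan S' (f x)) ->
  forall x, linspan S x -> linspan S' (f x).
Proof.
move=> fS x; elim=> [y /fS //| |y z _ IHy _ IHz|a y _ IHy].
- by rewrite linear0; exact: linspan0.
- by rewrite linearD; exact: linspanD.
- by rewrite linearZ; exact: linspanZ.
Qed.

Lemma linspan_image (f : {linear V -> W}) S :
  f @` linspan S = linspan (f @` S).
Proof.
rewrite eqEsubset; split=> [_ [x Sx <-]|y].
  by apply: linspan_morph Sx => z Sz; apply: linspan_in; exists z.
elim=> [_ [x Sx <-]| |_ _ _ [x Sx <-] _ [y' Sy <-]|a _ _ [x Sx <-]].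
- by exists x => //; exact: linspan_in.
- by exists 0; [exact: linspan0|exact: linear0].
- by exists (x + y'); [exact: linspanD|exact: linearD].
- by exists (a *: x); [exact: linspanZ|exact: linearZ].
Qed.

End LinearSpan.

Lemma linspan_sub (R : nzRingType) (V : lmodType R) (S S' : set V) :
  S `<=` linspan S' -> linspan S `<=` linspan S'.
Proof. by move=> SS' x; exact: (linspan_morph (f := idfun)). Qed.

(** * Powers of an ideal in an algebra *)

Section IdealPowers.
Variables (R : comNzRingType) (L : algType R).
Implicit Types (I J S : set L).

(** This puts all powers, including the zeroth, which is not defined as a span,
    in the form to which the closure properties of spans apply. *)
Lemma idealX_linspan I n : idealX I n = linspan (idealX I n).
Proof.
rewrite eqEsubset; split=> [x|]; first exact: linspan_in.
case: n => [//|n]; exact: linspan_sub.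
Qed.

Lemma idealX0 I n : idealX I n 0.
Proof. by rewrite idealX_linspan; exact: linspan0. Qed.

Lemma idealXD I n x y : idealX I n x -> idealX I n y -> idealX I n (x + y).
Proof. by rewrite idealX_linspan; exact: linspanD. Qed.

Lemma idealXN I n x : idealX I n x -> idealX I n (- x).
Proof. by rewrite idealX_linspan; exact: linspanN. Qed.

Lemma idealXB I n x y : idealX I n x -> idealX I n y -> idealX I n (x - y).
Proof. by rewrite idealX_linspan; exact: linspanB. Qed.

Lemma idealXZ I n a x : idealX I n x -> idealX I n (a *: x).
Proof. by rewrite idealX_linspan; exact: linspanZ. Qed.

Lemma idealXS I n x y : idealX I n x -> I y -> idealX I n.+1 (x * y).
Proof. by move=> Ix Iy; apply: linspan_in; exists x => //; exists y. Qed.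

Lemma idealX1 I x : I x -> idealX I 1 x.
Proof. by move=> Ix; rewrite -[x]mul1r; exact: idealXS. Qed.

(** The zeroth power is the whole algebra, so generators of the higher powers
    begin with an arbitrary factor, which absorbs [y]. *)
Lemma idealX_mull I n x y : idealX I n x -> idealX I n (y * x).
Proof.
elim: n x => // n IHn x; apply: (linspan_morph (f := GRing.mull_fun y idfun)).
by move=> _ [u Iu [v Iv <-]] /=; rewrite mulrA; apply: idealXS => //; exact: IHn.
Qed.

Section RightIdeal.
Variable I : set L.
Hypothesis I_mulr : forall u v, I u -> I (u * v).

Lemma idealX_mulr n x y : idealX I n x -> idealX I n (x * y).
Proof.
case: n => // n; apply: (linspan_morph (f := GRing.mulr_fun y idfun)).
by move=> _ [u Iu [v Iv <-]] /=; rewrite -mulrA;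
  apply: idealXS => //; exact: I_mulr.
Qed.

Lemma idealXM m n x y :
  idealX I m x -> idealX I n y -> idealX I (m + n) (x * y).
Proof.
elim: n y => [|n IHn] y Ix; first by rewrite addn0 => _; exact: idealX_mulr.
rewrite addnS; apply: (linspan_morph (f := GRing.mull_fun x idfun)).
by move=> _ [u Iu [v Iv <-]] /=; rewrite mulrA; apply: idealXS => //; exact: IHn.
Qed.

End RightIdeal.

Lemma linspanM (S T U : set L) :
  (forall x y, S x -> T y -> linspan U (x * y)) ->
  forall x y, linspan S x -> linspan T y -> linspan U (x * y).
Proof.
move=> STU x y Sx Ty.
apply: (linspan_morph (f := GRing.mull_fun x idfun)) Ty => {}y Ty /=.
by apply: (linspan_morph (f := GRing.mulr_fun y idfun)) Sx => {}x Sx; exact: STU.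
Qed.

End IdealPowers.

(** * The augmentation ideal of a group algebra *)

Lemma sub1M (L : nzRingType) (u v : L) :
  (u - 1) * (v - 1) = u * v - (u + v - 1).
Proof. by rewrite mulrBl mulrBr mulr1 mul1r -addrA -opprD addrA. Qed.

Section GroupAlgebra.
Variables (R : comNzRingType) (G : groupType).

(** Scalars are central, so left multiplication by a fixed element is a linear
    map too, to which [linspan_morph] applies. *)
Fact grscaleAr (a : R) (u v : grpring R G) : a *: (u * v) = u * (a *: v).
Proof.
have eqM (x y : grpring R G) : x * y = grmul x y by [].
have gr0 : grmul u 0 = 0 by rewrite -eqM mulr0.
by rewrite !eqM; have := grmul_linr u a v 0; rewrite /= gr0 !addr0.
Qed.

HB.instance Definition _ :=
  GRing.Lalgebra_isAlgebra.Build R (grpring R G) grscaleAr.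

Definition grelt (x : G) : grpring R G := << x >>.

Lemma grelt1 : grelt 1%g = 1. Proof. by []. Qed.

Lemma greltM x y : grelt (x * y)%g = grelt x * grelt y.
Proof. by rewrite -[RHS]/(grmul _ _) grmulU. Qed.

Lemma greltVK x : grelt x^-1%g * grelt x = 1.
Proof. by rewrite -greltM mulVg. Qed.

Lemma grpring_span (u : grpring R G) : linspan (range grelt) u.
Proof.
rewrite (monalgE u); elim/big_ind: _ => [|x y|k _].
- exact: linspan0.
- exact: linspanD.
have -> : << u@_k *g k >> = u@_k *: grelt k.
  by apply/malgP => x; rewrite mcoeffZ !mcoeffU mulrnAr mulr1.
by apply/linspanZ/linspan_in; exists k.
Qed.

HB.instance Definition _ := GRing.isLinear.Build R (grpring R G) R^o *:%R
  (@augmentation R G) (linext_is_linear _).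

Lemma augmentationU x : augmentation (grelt x) = 1.
Proof. exact: linextU. Qed.

Lemma augmentationZ a (u : grpring R G) :
  augmentation (a *: u) = a * augmentation u.
Proof. exact: linearZ. Qed.

Lemma augmentationM (u v : grpring R G) :
  augmentation (u * v) = augmentation u * augmentation v.
Proof.
elim: (grpring_span u) => [_ [x _ <-]| |x y _ IHx _ IHy|a x _ IHx].
- elim: (grpring_span v) => [_ [y _ <-]| |y z _ IHy _ IHz|a y _ IHy].
  + by rewrite -greltM !augmentationU mulr1.
  + by rewrite mulr0 !linear0 mulr0.
  + by rewrite mulrDr !linearD /= IHy IHz mulrDr.
  + by rewrite -scalerAr !augmentationZ IHy mulrCA.
- by rewrite mul0r !linear0 mul0r.
- by rewrite mulrDl !linearD /= IHx IHy mulrDl.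
- by rewrite -scalerAl !augmentationZ IHx mulrA.
Qed.

Lemma augideal_mulr (u v : grpring R G) :
  augideal R G u -> augideal R G (u * v).
Proof. by rewrite /augideal /= augmentationM => ->; rewrite mul0r. Qed.

Lemma augideal_grelt x : augideal R G (grelt x - 1).
Proof. by rewrite /augideal /= linearB /= -grelt1 !augmentationU subrr. Qed.

(** An element equals its difference with its augmentation when the latter is
    zero, and that difference depends linearly on the element. *)
Lemma augideal_span :
  augideal R G `<=` linspan [set grelt x - 1 | x in [set: G]].
Proof.
move=> u au0; have -> : u = u - (augmentation u : R) *: (1 : grpring R G).
  by rewrite au0 scale0r subr0.
elim: {au0} (grpring_span u) => [_ [x _ <-]| |x y _ IHx _ IHy|a x _ IHx].
- by rewrite augmentationU scale1r; apply: linspan_in; exists x.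
- by rewrite linear0 scale0r subr0; exact: linspan0.
- by rewrite linearD scalerDl opprD addrACA; exact: linspanD.
- by rewrite augmentationZ -scalerA -scalerBr; exact: linspanZ.
Qed.

Local Notation I n := (idealX (augideal R G) n).

(** The elements congruent to 1 modulo a left ideal form a subgroup, because
    [y z - 1 = y (z - 1) + (y - 1)] and [y^-1 - 1 = - y^-1 (y - 1)]. *)
Lemma generated_sub1 (S : set G) n :
  (forall x, S x -> I n (grelt x - 1)) ->
  forall x, generated S x -> I n (grelt x - 1).
Proof.
move=> S_I x; elim=> [//| |y z _ Iy _ Iz|y _ Iy].
- by rewrite grelt1 subrr; exact: idealX0.
- have -> : grelt (y * z)%g - 1 = grelt y * (grelt z - 1) + (grelt y - 1).
    by rewrite greltM mulrBr mulr1 subrKA.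
  by apply: idealXD => //; exact: idealX_mull.
- have -> : grelt y^-1%g - 1 = - (grelt y^-1%g * (grelt y - 1)).
    by rewrite mulrBr mulr1 greltVK opprB.
  by apply: idealXN; exact: idealX_mull.
Qed.

(** A group commutator differs from 1 by a unit times the ring commutator of
    [x] and [y], which is also that of [x - 1] and [y - 1]. *)
Lemma commg_sub1 x y : I 2 (grelt [~ x, y]%g - 1).
Proof.
have -> : grelt [~ x, y]%g - 1 = grelt (y * x)^-1%g *
    ((grelt x - 1) * (grelt y - 1) - (grelt y - 1) * (grelt x - 1)).
  have -> : (grelt x - 1) * (grelt y - 1) - (grelt y - 1) * (grelt x - 1)
      = grelt (x * y)%g - grelt (y * x)%g.
    by rewrite !sub1M (addrC (grelt y)) [- (_ * _ - _)]opprB subrKA !greltM.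
  rewrite mulrBr greltVK -greltM; congr (grelt _ - 1).
  by rewrite /commg /conjg invgM !mulgA.
by apply/idealX_mull/idealXB; apply: idealXS; do ?apply: idealX1;
  exact: augideal_grelt.
Qed.

(** In characteristic 2, [y^2 - 1 = (y - 1)^2]. *)
Lemma gamma22_sub1 x : 2 \in [pchar R] -> gamma22 x -> I 2 (grelt x - 1).
Proof.
move=> R2; have addLL (u : grpring R G) : u + u = 0.
  by rewrite -mulr2n -scaler_nat pcharf0 // scale0r.
apply: generated_sub1 => {}x [|[y _ <-]].
  by apply: generated_sub1 => _ [y _ [z _ <-]]; exact: commg_sub1.
have -> : grelt (y ^+ 2)%g - 1 = (grelt y - 1) * (grelt y - 1).
  rewrite sub1M addLL sub0r opprK -greltM -expg2; congr (_ + _).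
  (* what remains is [-1 = 1] *)
  by apply/eqP; rewrite eq_sym -addr_eq0 addLL.
by apply/idealXS/augideal_grelt/idealX1/augideal_grelt.
Qed.

End GroupAlgebra.

(** * Functoriality of group algebras *)

Section Functoriality.
Variables (R : comNzRingType) (G H : groupType).
Variable f : {multiplicative G -> H}.

Definition grmap : grpring R G -> grpring R H := linext (fun x => grelt R (f x)).

HB.instance Definition _ := GRing.isLinear.Build R (grpring R G)
  (grpring R H) *:%R grmap (linext_is_linear _).

Lemma grmapU x : grmap (grelt R x) = grelt R (f x).
Proof. exact: linextU. Qed.

Fact grmap_is_monoid_morphism : monoid_morphism grmap.
Proof.
split=> [|u v]; first by rewrite -grelt1 grmapU gmul1.
elim: (grpring_span u) => [_ [x _ <-]| |x y _ IHx _ IHy|a x _ IHx].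
- elim: (grpring_span v) => [_ [y _ <-]| |y z _ IHy _ IHz|a y _ IHy].
  + by rewrite -greltM !grmapU gmulfM greltM.
  + by rewrite mulr0 !linear0 mulr0.
  + by rewrite mulrDr !linearD /= IHy IHz mulrDr.
  + by rewrite -scalerAr !linearZ /= IHy scalerAr.
- by rewrite mul0r !linear0 mul0r.
- by rewrite mulrDl !linearD /= IHx IHy mulrDl.
- by rewrite -scalerAl !linearZ /= IHx scalerAl.
Qed.

HB.instance Definition _ := GRing.isMonoidMorphism.Build (grpring R G)
  (grpring R H) grmap grmap_is_monoid_morphism.

Lemma augmentation_grmap u : augmentation (grmap u) = augmentation u.
Proof.
elim: (grpring_span u) => [_ [x _ <-]| |x y _ IHx _ IHy|a x _ IHx].
- by rewrite grmapU !augmentationU.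
- by rewrite !linear0.
- by rewrite !linearD /= IHx IHy.
- by rewrite linearZ !augmentationZ IHx.
Qed.

Lemma grmap_idealX n u :
  idealX (augideal R G) n u -> idealX (augideal R H) n (grmap u).
Proof.
elim: n u => [//|n IHn]; apply: linspan_morph => _ [u Iu [v Iv <-]].
rewrite rmorphM; apply: idealXS; first exact: IHn.
by rewrite /augideal /= augmentation_grmap.
Qed.

End Functoriality.

Arguments grmap R {G H} f u.

(** * Endomorphisms acting trivially modulo the square *)

Section UnipotentEndomorphism.
Variables (R : comNzRingType) (G : groupType) (f : {multiplicative G -> G}).

Local Notation I n := (idealX (augideal R G) n).

Hypothesis f_triv : forall x, I 2 (grelt R (f x) - grelt R x).

Lemma grmap_sub_id2 u : I 2 (grmap R f u - u).
Proof.
elim: (grpring_span u) => [_ [x _ <-]| |x y _ IHx _ IHy|a x _ IHx].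
- by rewrite grmapU.
- by rewrite linear0 subr0; exact: idealX0.
- by rewrite linearD opprD addrACA; exact: idealXD.
- by rewrite linearZ -scalerBr; exact: idealXZ.
Qed.

(** Triviality on the first graded piece propagates to all of them by the
    twisted Leibniz rule [f (v w) - v w = (f v - v) (f w) + v (f w - w)]. *)
Lemma grmap_sub_id n u : I n u -> I n.+1 (grmap R f u - u).
Proof.
elim: n u => [|n IHn] u.
  move=> _; apply: idealX1.
  by rewrite /augideal /= linearB /= augmentation_grmap subrr.
elim=> [_ [v Iv [w Iw <-]]| |x y _ IHx _ IHy|a x _ IHx].
- have -> : grmap R f (v * w) - v * w =
      (grmap R f v - v) * grmap R f w + v * (grmap R f w - w).
    by rewrite rmorphM mulrBl mulrBr subrKA.
  apply: idealXD.
    apply: idealXS; first exact: IHn.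
    by rewrite /augideal /= augmentation_grmap.
  rewrite -addn2; apply: idealXM => //; first exact: augideal_mulr.
  exact: grmap_sub_id2.
- by rewrite linear0 subr0; exact: idealX0.
- by rewrite linearD opprD addrACA; exact: idealXD.
- by rewrite linearZ -scalerBr; exact: idealXZ.
Qed.

End UnipotentEndomorphism.

(** * The product filtration on a semidirect product *)

Section SemidirectFiltration.
Variables (R : comNzRingType) (A C : groupType) (act : autAction A C).

Local Notation G := (semidirect act).
Local Notation IA n := (idealX (augideal R A) n).
Local Notation IC n := (idealX (augideal R C) n).

Fact sd_inl_is_multiplicative : {morph sd_inl act : a b / (a * b)%g}.
Proof.
move=> a b; rewrite -[RHS]/(sd_mul _ _) /sd_mul /=.
by rewrite aut_act1 mulg1.
Qed.

HB.instance Definition _ :=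
  monoid.isMultiplicative.Build A G (sd_inl act) sd_inl_is_multiplicative.

Fact sd_inr_is_multiplicative : {morph sd_inr act : a b / (a * b)%g}.
Proof.
move=> a b; rewrite -[RHS]/(sd_mul _ _) /sd_mul /=.
by rewrite gmul1 mulg1.
Qed.

HB.instance Definition _ :=
  monoid.isMultiplicative.Build C G (sd_inr act) sd_inr_is_multiplicative.

Local Notation jA := (grmap R (sd_inl act)).
Local Notation jC := (grmap R (sd_inr act)).

(** The right-hand side of the theorem, transported inside the group algebra of
    the semidirect product, where it can be multiplied; see
    [sd_filtrationE]. *)
Definition sd_filtration n : set (grpring R G) :=
  linspan (\bigcup_(p in [set p : nat * nat | (p.1 + p.2)%N = n])
    [set jA u * jC v | u in IA p.1 & v in IC p.2]).

Lemma sd_filtration_in i h u v :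
  IA i u -> IC h v -> sd_filtration (i + h) (jA u * jC v).
Proof.
by move=> Iu Iv; apply: linspan_in; exists (i, h) => //; exists u => //; exists v.
Qed.

Lemma sd_filtrationE n : sd_filtration n =
  sd_tens act @`
    linspan (\bigcup_(p in [set p : nat * nat | (p.1 + p.2)%N = n])
      tensS (IA p.1) (IC p.2)).
Proof.
pose F := GRing.isLinear.Build R (grtensor R A C) (grpring R G) *:%R
  (@sd_tens A C act R) (linext_is_linear _).
pose t : {linear _ -> _} := HB.pack (@sd_tens A C act R) F.
rewrite -[@sd_tens _ _ _ _]/(t : _ -> _) linspan_image.
have tE u v : t (tens u v) = jA u * jC v by exact: sd_tensE.
rewrite eqEsubset; split; apply: linspan_sub => z.
  case=> p pn [u Iu [v Iv <-]]; rewrite -tE; apply/linspan_in.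
  by exists (tens u v) => //; exists p => //; apply: linspan_in;
    exists u => //; exists v.
case=> w [p pn tw] <-; apply: linspan_morph tw => _ [u Iu [v Iv <-]].
by rewrite tE; apply: linspan_in; exists p => //; exists u => //; exists v.
Qed.

Lemma sd_filtration_sub n : sd_filtration n `<=` idealX (augideal R G) n.
Proof.
rewrite [X in _ `<=` X]idealX_linspan; apply: linspan_sub.
move=> z [p /= <- [u Iu [v Iv <-]]]; apply: linspan_in.
by apply: idealXM; [exact: augideal_mulr|exact: grmap_idealX..].
Qed.

Lemma grelt_sdE (x : G) : grelt R x = jA (grelt R x.1) * jC (grelt R x.2).
Proof. by rewrite !grmapU -greltM sd_inM -surjective_pairing. Qed.

(** The action of [C] becomes conjugation in the semidirect product. *)
Lemma sd_twist c u :
  jC (grelt R c) * jA u = jA (grmap R (act c) u) * jC (grelt R c).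
Proof.
elim: (grpring_span u) => [_ [a _ <-]| |x y _ IHx _ IHy|b x _ IHx].
- by rewrite !grmapU -!greltM /= -sd_inJ mulgVK.
- by rewrite !linear0 mulr0 mul0r.
- by rewrite !linearD /= mulrDr mulrDl IHx IHy.
- by rewrite !linearZ /= -scalerAr -scalerAl IHx.
Qed.

Lemma sd_filtration0 u : sd_filtration 0 u.
Proof.
apply: linspan_sub (grpring_span u) => _ [x _ <-].
by rewrite grelt_sdE -[0%N]/(0 + 0)%N; exact: sd_filtration_in.
Qed.

(** Moving the [C]-component of [x] past [u] puts the product back in the form
    of an element of [A]'s algebra followed by one of [C]'s. *)
Lemma sd_grelt_mul (x : G) u v : grelt R x * (jA u * jC v) =
  jA (grelt R x.1 * grmap R (act x.2) u) * jC (grelt R x.2 * v).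
Proof.
have twist (L : nzRingType) (a c u' w v' : L) :
    c * u' = w * c -> a * c * (u' * v') = a * w * (c * v').
  by move=> cu; rewrite mulrA -(mulrA a) cu !mulrA.
by rewrite grelt_sdE (twist _ _ _ _ _ _ (sd_twist _ _)) !rmorphM.
Qed.

Lemma sd_filtration_mull n w z : sd_filtration n z -> sd_filtration n (w * z).
Proof.
move: (grpring_span w).
apply: linspanM => _ _ [x _ <-] [p /= <- [u Iu [v Iv <-]]].
rewrite sd_grelt_mul.
by apply: sd_filtration_in; apply: idealX_mull => //; exact: grmap_idealX.
Qed.

Section UnipotentAction.

Hypothesis act_triv : forall c a, IA 2 (grelt R (act c a) - grelt R a).

(** The crucial inclusion of [D T_n] in [T_(n+1)]: each of the three terms in the
    expansion of [(x - 1) u v] gains one degree, in its [C]-factor for the first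
    and in its [A]-factor for the other two. *)
Lemma sd_filtration_mull_aug n d z :
  augideal R G d -> sd_filtration n z -> sd_filtration n.+1 (d * z).
Proof.
move/augideal_span; apply: linspanM => _ _ [x _ <-] [p /= pn [u Iu [v Iv <-]]].
set a := grelt R x.1; set c := grelt R x.2; set w := grmap R (act x.2) u.
have -> : (grelt R x - 1) * (jA u * jC v) =
    jA (a * w) * jC ((c - 1) * v) + jA (a * (w - u)) * jC v +
    jA ((a - 1) * u) * jC v.
  rewrite mulrBl mul1r sd_grelt_mul -/a -/c -/w.
  by rewrite !(mulrBl, mulrBr, mul1r) !rmorphB !(mulrBl, mulrBr) !subrKA.
have Iw : IA p.1 w by exact: grmap_idealX.
apply: linspanD; first apply: linspanD.
- rewrite -pn -addnS; apply: sd_filtration_in; first exact: idealX_mull.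
  rewrite -add1n; apply: idealXM => //; first exact: augideal_mulr.
  exact/idealX1/augideal_grelt.
- rewrite -pn -addSn; apply: sd_filtration_in => //.
  exact/idealX_mull/grmap_sub_id.
- rewrite -pn -addSn -add1n; apply: sd_filtration_in => //.
  apply: idealXM => //; first exact: augideal_mulr.
  exact/idealX1/augideal_grelt.
Qed.

(** Allowing any [n], although only [n = 0] is wanted, lets the induction peel
    off the last factor of [D^(m+1) = D^m D], as in the definition of powers. *)
Lemma sd_filtration_mull_idealX m n u z :
  idealX (augideal R G) m u -> sd_filtration n z -> sd_filtration (m + n) (u * z).
Proof.
elim: m n u z => [|m IHm] n u z Iu Tz; first exact: sd_filtration_mull.
rewrite addSnnS; move: Iu.
apply: (linspan_morph (f := GRing.mulr_fun z idfun)) => _ [v Iv [d Id <-]] /=.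
by rewrite -mulrA; apply: IHm => //; exact: sd_filtration_mull_aug.
Qed.

Lemma idealX_sd_filtration n : idealX (augideal R G) n = sd_filtration n.
Proof.
rewrite eqEsubset; split; last exact: sd_filtration_sub.
move=> u Iu; rewrite -[u]mulr1 -[n]addn0.
by apply: sd_filtration_mull_idealX => //; exact: sd_filtration0.
Qed.

End UnipotentAction.
End SemidirectFiltration.

(** * 2-almost direct products *)

Lemma two_almost_direct_gamma22 (A C : groupType) (act : autAction A C) c a :
  two_almost_direct act -> gamma22 (a^-1 * act c a)%g.
Proof.
move=> act2; have := act2 c (\pi_(H1F2 A) a)%qT.
by rewrite H1F2_actE => /eqmodP; rewrite /= gamma22_eqv_sym => /asboolP.
Qed.

Lemma two_almost_direct_sub (R : comNzRingType) (A C : groupType)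
    (act : autAction A C) c a :
  2 \in [pchar R] -> two_almost_direct act ->
  idealX (augideal R A) 2 (grelt R (act c a) - grelt R a).
Proof.
move=> R2 act2.
have -> : grelt R (act c a) - grelt R a =
    grelt R a * (grelt R (a^-1 * act c a)%g - 1).
  by rewrite mulrBr mulr1 -greltM mulVKg.
by apply/idealX_mull/gamma22_sub1 => //; exact: two_almost_direct_gamma22.
Qed.

Theorem theorem5 (A C : groupType) (act : autAction A C)
  (act2 : two_almost_direct act) (k : nat) :
  idealX (augideal 'F_2 (semidirect act)) k =
  sd_tens act @`
    linspan (\bigcup_(p in [set p : nat * nat | (p.1 + p.2)%N = k])
      tensS (idealX (augideal 'F_2 A) p.1) (idealX (augideal 'F_2 C) p.2)).
Proof.
rewrite -sd_filtrationE; apply: idealX_sd_filtration => c a.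
exact: two_almost_direct_sub.
Qed.
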